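(* Let $\Gamma$ be a finite group and $\Delta=(\delta_1,\dots,\delta_d)$ a finite list of elements of $\Gamma$ generating $\Gamma$, and let $G$ be the directed Cayley graph with vertex set $\Gamma$ and, for each $g\in\Gamma$ and each entry $\delta$ of $\Delta$, a directed edge $(g,g\delta)$ labeled by that entry. For each $g\in\Gamma$, $g\neq e$, choose a word $w(g)=\delta(1)\delta(2)\cdots\delta(m)$ in the entries of $\Delta$ whose product equals $g$; it determines the directed path $e,\ \delta(1),\ \delta(1)\delta(2),\dots, g$ from $e$ to $g$. Suppose each occurrence of a letter in each word $w(g)$ is assigned a positive integer time such that times strictly increase along each word, and no entry of $\Delta$ is assigned the same time at two different occurrences (in the same or different words). For $h\in\Gamma$, let $hw(g)$ denote the directed path $h,\ h\delta(1),\ h\delta(1)\delta(2),\dots,hg$ from $h$ to $hg$, whose edges receive the same times as the corresponding letters of $w(g)$. Then the collection of paths $hw(g)$, $h\in\Gamma$, $g\in\Gamma\setminus\{e\}$, is a communication graph for transpose on $G$; that is, it contains a time-increasing path from every vertex to every other vertex and no edge of $G$ receives the same time twice.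
   Context: A communication graph (schedule) for transpose on a directed graph $G$ is a choice, for every ordered pair $(u,w)$ of distinct vertices, of a directed path from $u$ to $w$ with edges labeled by positive integer times strictly increasing along the path, such that no edge of $G$ receives the same time twice over all the paths. Edges arising from different entries of $\Delta$ are considered distinct edges even if the entries coincide as group elements. *)

(* Defs.v *)
From HB Require Import structures.
From mathcomp Require Import all_boot all_order all_fingroup.
Set Implicit Arguments.
Unset Strict Implicit.
Unset Printing Implicit Defensive.

Local Open Scope group_scope.

(* Directed multigraphs: distinct edges may have the same source and target. *)
Record digraph := Digraph {
  vertex : finType;
  edge : finType;
  src : edge -> vertex;
  tgt : edge -> vertex
}.

(* Vertices may repeat: the path traced by an arbitrary word in the generators
   need not be simple. *)
Fixpoint dipath (G : digraph) (u : vertex G) (p : seq (edge G)) (v : vertex G)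
    : Prop :=
  if p is e :: p' then src e = u /\ dipath (tgt e) p' v else u = v.

Definition time_increasing (L : Type) (s : seq (L * nat)) : Prop :=
  all (fun t => 0 < t)%N (unzip2 s) /\ sorted ltn (unzip2 s).

(* [P u v] is the chosen path from u to v, each edge paired with its time;
   the diagonal values [P u u] play no role.  In the last clause (u, v, i) is
   an occurrence of the edge e, at position i of the path from u to v. *)
Definition communication_graph (G : digraph)
    (P : vertex G -> vertex G -> seq (edge G * nat)) : Prop :=
  [/\ forall u v, u != v -> dipath u (unzip1 (P u v)) v,
      forall u v, u != v -> time_increasing (P u v)
    & forall u v u' v' i j (e : edge G) (t : nat), u != v -> u' != v' ->
        onth (P u v) i = Some (e, t) -> onth (P u' v') j = Some (e, t) ->
        [/\ u = u', v = v' & i = j]].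

(* The edge (g, a) goes from g to g times the a-th entry of Delta; labelling by
   the index keeps the edges of coinciding entries apart. *)
Definition cayley (gT : finGroupType) (d : nat) (Delta : d.-tuple gT)
    : digraph :=
  @Digraph gT (gT * 'I_d)%type fst (fun e => e.1 * tnth Delta e.2).

Fixpoint translate (gT : finGroupType) (d : nat) (Delta : d.-tuple gT)
    (h : gT) (w : seq ('I_d * nat)) : seq (edge (cayley Delta) * nat) :=
  if w is (a, t) :: w' then
    ((h, a), t) :: translate Delta (h * tnth Delta a) w'
  else [::].

(* Main.v *)
(** Translating by h sends the i-th letter of w(g) to the edge whose source is h
    times the product of the first i letters.  If an edge gets the same time in
    h w(g) and h' w(g'), its label gets that time in both words, so g = g' at the
    same position i; the two sources then share the same i-letter prefix product,
    which cancels to give h = h'. *)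
Require Import Defs.
From HB Require Import structures.
From mathcomp Require Import all_boot all_order all_fingroup.
Set Implicit Arguments.
Unset Strict Implicit.
Unset Printing Implicit Defensive.

Local Open Scope group_scope.

Lemma unzip2_translate (gT : finGroupType) (d : nat) (Delta : d.-tuple gT)
    (h : gT) (w : seq ('I_d * nat)) :
  unzip2 (translate Delta h w) = unzip2 w.
Proof. by elim: w h => [|[a t] w IHw] h //=; rewrite IHw. Qed.

(** The first edge ends at [h * tnth Delta a], exactly where the translate of the remaining word
    starts. *)
Lemma dipath_translate (gT : finGroupType) (d : nat) (Delta : d.-tuple gT)
    (h : gT) (w : seq ('I_d * nat)) :
  @dipath (cayley Delta) h (unzip1 (translate Delta h w))
    (h * \prod_(a <- unzip1 w) tnth Delta a).
Proof.
elim: w h => [|[a t] w IHw] h /=; first by rewrite big_nil mulg1.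
by split=> //; rewrite big_cons mulgA; apply: IHw.
Qed.

Lemma onth_translate (gT : finGroupType) (d : nat) (Delta : d.-tuple gT)
    (h : gT) (w : seq ('I_d * nat)) (i : nat) (x : gT) (a : 'I_d) (t : nat) :
  onth (translate Delta h w) i = Some ((x, a), t) ->
  onth w i = Some (a, t) /\
  x = h * \prod_(b <- take i (unzip1 w)) tnth Delta b.
Proof.
elim: w h i => [|[b s] w IHw] h [|i] //=.
  by case=> -> -> ->; rewrite big_nil mulg1.
by case/IHw=> -> ->; rewrite big_cons mulgA.
Qed.

Theorem theorem2 (gT : finGroupType) (d : nat) (Delta : d.-tuple gT)
  (gen_Delta : <<[set x in Delta]>> = [set: gT])
  (w : gT -> seq ('I_d * nat))
  (w_prod : forall g : gT, g != 1 ->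
     \prod_(a <- unzip1 (w g)) tnth Delta a = g)
  (w_incr : forall g : gT, g != 1 -> time_increasing (w g))
  (w_inj : forall (g g' : gT) (i j : nat) (a : 'I_d) (t : nat),
     g != 1 -> g' != 1 ->
     onth (w g) i = Some (a, t) -> onth (w g') j = Some (a, t) ->
     g = g' /\ i = j) :
  exists P : gT -> gT -> seq (edge (cayley Delta) * nat),
    (forall h g : gT, g != 1 -> P h (h * g) = translate Delta h (w g)) /\
    @communication_graph (cayley Delta) P.
Proof.
have quot1 (u v : gT) : u != v -> u^-1 * v != 1.
  by apply: contra => /eqP/(canRL (mulKVg u)); rewrite mulg1 => ->.
(* A path from [u] to [v] must spell [u^-1 * v]; on the diagonal this takes the arbitrary word
   [w 1]. *)
exists (fun u v => translate Delta u (w (u^-1 * v))); split=> [h g _|].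
  by rewrite mulKg.
split=> [u v /quot1 uv1 | u v /quot1 uv1 |].
- have := dipath_translate Delta u (w (u^-1 * v)).
  by rewrite w_prod // mulKVg.
- by rewrite /time_increasing unzip2_translate; apply: w_incr.
move=> u v u' v' i j [x a] t /quot1 uv1 /quot1 uv1'.
(* Eliminating the common source [x] equates [u] and [u'], each times its own prefix product. *)
move=> /onth_translate[wi ->] /onth_translate[wj].
have [eq_g eq_ij] := w_inj _ _ _ _ _ _ uv1 uv1' wi wj.
rewrite -eq_g -eq_ij => /mulIg eq_u; split=> //.
(* The endpoint is recovered from start and quotient: [v = u * (u^-1 * v)]. *)
by rewrite -(mulKVg u v) eq_g eq_u mulKVg.
Qed.
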